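(* Let $n\ge1$, $1\le i\le n$ be integers, $\alpha,\beta>0$, $\tau\ge0$ with $i\beta(\tau+1)>\tau$. Put $a=\frac{(n-i+1)\tau\beta+(n-i+1)\beta+\tau}{\beta}$ and $b=\frac{i\tau\beta+i\beta-\tau}{\beta}$. Then $$\xi^{(i)}_\tau(\beta)=\int_0^\infty\frac{\partial}{\partial\beta}\log f^{(i)}_{\alpha,\beta}(x)\, f^{(i)}_{\alpha,\beta}(x)^{\tau+1}dx=\left(\frac{\beta}{\alpha}\right)^{\tau}\frac{c(i,n)^{\tau+1}}{\beta}B(a,b)\,\frac{\tau}{1+\tau}\left[\frac1\beta\big(\Psi(b)-\Psi(a)\big)+1\right],$$ and $K^{(i)}_\tau(\beta)=J^{(i)}_{2\tau}(\beta)-\xi^{(i)}_\tau(\beta)^2$.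
   Context: $c(i,n)=\frac{n!}{(n-i)!(i-1)!}$ and $f^{(i)}_{\alpha,\beta}(x)=\frac{c(i,n)\beta (x/\alpha)^{i\beta-1}}{\alpha(1+(x/\alpha)^\beta)^{n+1}}$, $x>0$, is the density of the $i$-th order statistic of a sample of size $n$ from the log-logistic distribution with scale $\alpha$ and shape $\beta$. Derivatives are with respect to $\beta$ with $\alpha$ known; $J^{(i)}_\tau(\beta)=\int_0^\infty(\partial_\beta\log f^{(i)}_{\alpha,\beta})^2(f^{(i)}_{\alpha,\beta})^{\tau+1}dx$, and $K^{(i)}_\tau(\beta)$ denotes $J^{(i)}_{2\tau}(\beta)-\xi^{(i)}_\tau(\beta)^2$. $B$ is the Beta function and $\Psi$ the digamma function. *)

(* Defs.v *)
From Stdlib Require Import Reals Factorial.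
From Coquelicot Require Import Coquelicot.
Open Scope R_scope.

Definition int0inf (g : R -> R) : R :=
  RInt_gen g (at_right 0) (Rbar_locally p_infty).

Definition Gamma (x : R) : R :=
  int0inf (fun t => Rpower t (x - 1) * exp (- t)).

Definition Beta (a b : R) : R :=
  RInt_gen (fun t => Rpower t (a - 1) * Rpower (1 - t) (b - 1))
           (at_right 0) (at_left 1).

Definition Psi (x : R) : R := Derive (fun y => ln (Gamma y)) x.

Definition cc (i n : nat) : R :=
  INR (fact n) / (INR (fact (n - i)) * INR (fact (i - 1))).

(* density of the i-th order statistic of a log-logistic(alpha, beta) sample of size n *)
Definition f_os (i n : nat) (alpha beta x : R) : R :=
  cc i n * beta * Rpower (x / alpha) (INR i * beta - 1)
  / (alpha * Rpower (1 + Rpower (x / alpha) beta) (INR n + 1)).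

Definition score (i n : nat) (alpha beta x : R) : R :=
  Derive (fun b => ln (f_os i n alpha b x)) beta.

Definition xi (i n : nat) (alpha tau beta : R) : R :=
  int0inf (fun x => score i n alpha beta x * Rpower (f_os i n alpha beta x) (tau + 1)).

Definition J (i n : nat) (alpha tau beta : R) : R :=
  int0inf (fun x => (score i n alpha beta x) ^ 2 * Rpower (f_os i n alpha beta x) (tau + 1)).

Definition K (i n : nat) (alpha tau beta : R) : R :=
  J i n alpha (2 * tau) beta - (xi i n alpha tau beta) ^ 2.

(* Main.v *)
(** Put [t = beta ln (x / alpha)], [s = a + b = (n + 1) (tau + 1)] and
[k_(a,b)(t) = exp (b t) (1 + exp t)^(- a - b)], whose integral over the line is [B(a,b)]. The
integrand of [xi] becomes a constant times [k_(a,b) + i t k_(a,b) - (n + 1) t k_(a,b+1)].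
Integrating the derivative of [t k_(a,b)] gives
[s B1(a,b+1) = B(a,b) + b B1(a,b)] for [B1(a,b) = int t k_(a,b)], so only
[B1(a,b) = B(a,b) (Psi b - Psi a)] remains.

This is proved without [B(a,b) = Gamma a Gamma b / Gamma (a + b)]. Both [B1 / B] and
[Psi b - Psi a] grow by [1 / b] when [b] grows by 1, drop by [1 / a] when [a] grows by 1, vanish
for [a = b] and increase along [a + b = const]. So their difference is invariant under
[(a, b) -> (a + 1, b + 1)], while each of them is [O(1 / m)] at [(a + m, b + m)], hence
the difference is zero. *)

Require Import Defs.
From Stdlib Require Import Reals Lra Lia.
From Coquelicot Require Import Coquelicot.
Open Scope R_scope.

(** * Improper integrals *)

Lemma ex_RInt_cont (g : R -> R) (a b : R) :
  (forall x, continuous g x) -> ex_RInt g a b.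
Proof.
  intros Hg. apply (ex_RInt_continuous (V := R_CompleteNormedModule)).
  intros z _. apply Hg.
Qed.

(** The absolute value on the right makes the bound independent of the order of [u] and [v], which
    the Cauchy argument below cannot control. *)
Lemma abs_RInt_le_antiderivative (g H h : R -> R) (u v : R) :
  (forall x, continuous g x) -> (forall x, continuous h x) ->
  (forall x, is_derive H x (h x)) -> (forall x, Rabs (g x) <= h x) ->
  Rabs (RInt g u v) <= Rabs (H v - H u).
Proof.
  intros Cg Ch DH Hgh.
  assert (Hle : forall u v, u <= v -> Rabs (RInt g u v) <= H v - H u).
  { intros c d Hcd.
    apply (norm_RInt_le (V := R_NormedModule) g h c d).
    - exact Hcd.
    - intros x _. apply Hgh.
    - apply (RInt_correct (V := R_CompleteNormedModule)), ex_RInt_cont, Cg.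
    - apply (is_RInt_derive (V := R_CompleteNormedModule)); intros; auto. }
  destruct (Rle_dec u v) as [Huv | Huv].
  - apply Rle_trans with (1 := Hle u v Huv), Rle_abs.
  - assert (Hvu : v <= u) by lra.
    rewrite <- (opp_RInt_swap (V := R_CompleteNormedModule)) by now apply ex_RInt_cont.
    unfold opp; simpl. rewrite Rabs_Ropp.
    apply Rle_trans with (1 := Hle v u Hvu).
    rewrite Rabs_minus_sym. apply Rle_abs.
Qed.

(** Cauchy criterion along the product filter: two integrals of [g] differ by integrals over short
    pieces at either end, each bounded by an increment of [H], which converges there. *)
Lemma ex_RInt_gen_dominated (Fa Fb : (R -> Prop) -> Prop) (g H h : R -> R) (la lb : R) :
  ProperFilter Fa -> ProperFilter Fb ->
  (forall x, continuous g x) -> (forall x, continuous h x) ->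
  (forall x, is_derive H x (h x)) -> (forall x, Rabs (g x) <= h x) ->
  filterlim H Fa (locally la) -> filterlim H Fb (locally lb) ->
  ex_RInt_gen g Fa Fb.
Proof.
  intros PFa PFb Cg Ch DH Hgh HFa HFb.
  destruct (proj1 (filterlim_locally_cauchy (U := R_CompleteNormedModule)
    (F := filter_prod Fa Fb) (fun ab => RInt g (fst ab) (snd ab)))) as [l Hl].
  - intros eps.
    (* Two values of [H] within [eps / 4] of the same limit differ by less than [eps / 2], and there
       are two ends. *)
    assert (He : 0 < eps / 4) by (destruct eps; simpl; lra).
    exists (fun ab => Rabs (H (fst ab) - la) < eps / 4 /\ Rabs (H (snd ab) - lb) < eps / 4).
    split.
    + eapply Filter_prod.
      * apply (proj1 (filterlim_locally H la) HFa (mkposreal _ He)).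
      * apply (proj1 (filterlim_locally H lb) HFb (mkposreal _ He)).
      * intros x y Hx Hy. split; [exact Hx | exact Hy].
    + intros [a b] [a' b'] [Ha Hb] [Ha' Hb']; simpl in *.
      change (Rabs (RInt g a' b' - RInt g a b) < eps).
      assert (E : RInt g a' b' - RInt g a b = RInt g a' a + RInt g b b').
      { rewrite <- (RInt_Chasles (V := R_CompleteNormedModule) g a' a b')
          by now apply ex_RInt_cont.
        rewrite <- (RInt_Chasles (V := R_CompleteNormedModule) g a b b')
          by now apply ex_RInt_cont.
        unfold plus; simpl; ring. }
      rewrite E.
      pose proof (abs_RInt_le_antiderivative g H h a' a Cg Ch DH Hgh) as H1.
      pose proof (abs_RInt_le_antiderivative g H h b b' Cg Ch DH Hgh) as H2.
      pose proof (Rabs_triang (RInt g a' a) (RInt g b b')) as H3.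
      apply Rabs_def2 in Ha; apply Rabs_def2 in Ha';
        apply Rabs_def2 in Hb; apply Rabs_def2 in Hb'.
      assert (Rabs (H a - H a') < eps / 2) by (apply Rabs_def1; lra).
      assert (Rabs (H b' - H b) < eps / 2) by (apply Rabs_def1; lra).
      lra.
  - exists l.
    apply (filterlimi_lim_ext_loc (fun ab => RInt g (fst ab) (snd ab))); [|exact Hl].
    apply filter_forall. intros ab.
    apply (RInt_correct (V := R_CompleteNormedModule)), ex_RInt_cont, Cg.
Qed.

(** If [l < m], properness of the filters yields one pair of endpoints whose integral is both at
    least [m] and within [m - l] of [l]. *)
Lemma is_RInt_gen_ge (Fa Fb : (R -> Prop) -> Prop) (g : R -> R) (m l : R) :
  ProperFilter Fa -> ProperFilter Fb ->
  filter_prod Fa Fb (fun ab => m <= RInt g (fst ab) (snd ab)) ->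
  is_RInt_gen g Fa Fb l -> m <= l.
Proof.
  intros PFa PFb Hm Hl.
  destruct (Rle_dec m l) as [|Hlt]; [assumption | exfalso].
  assert (He : 0 < m - l) by lra.
  pose proof (proj1 (filterlimi_locally _ _) Hl (mkposreal _ He)) as Hball.
  destruct (filter_ex (F := filter_prod Fa Fb) _ (filter_and _ _ Hm Hball))
    as [ab [H1 [z [Hz Hb]]]].
  apply (is_RInt_unique (V := R_CompleteNormedModule)) in Hz. rewrite Hz in H1.
  change (Rabs (z - l) < m - l) in Hb. apply Rabs_def2 in Hb. lra.
Qed.

(** [psi] inverts [phi] on the right only near the two ends, and [f] is continuous only on the range
    of [phi]. This fits integrands built from [Rpower], which are regular only on an open
    interval. *)
Lemma is_RInt_gen_subst (f phi dphi psi : R -> R) (Fa Fb Ga Gb : (R -> Prop) -> Prop) (l : R) :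
  Filter Ga -> Filter Gb ->
  (forall x, is_derive phi x (dphi x)) -> (forall x, continuous dphi x) ->
  (forall x, continuous f (phi x)) ->
  filterlim psi Ga Fa -> filterlim psi Gb Fb ->
  Ga (fun y => phi (psi y) = y) -> Gb (fun y => phi (psi y) = y) ->
  is_RInt_gen (fun x => dphi x * f (phi x)) Fa Fb l ->
  is_RInt_gen f Ga Gb l.
Proof.
  intros FGa FGb Dphi Cdphi Cf HFa HFb HGa HGb Hint P HP.
  destruct (Hint P HP) as [Q S HQ HS HQS].
  apply Filter_prod with (fun y => phi (psi y) = y /\ Q (psi y))
                         (fun y => phi (psi y) = y /\ S (psi y)).
  - apply filter_and; [exact HGa | exact (HFa Q HQ)].
  - apply filter_and; [exact HGb | exact (HFb S HS)].
  - intros y z [Ey Qy] [Ez Sz].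
    destruct (HQS _ _ Qy Sz) as [v [Hv Pv]]; simpl in Hv.
    exists v; split; [|exact Pv]. simpl.
    assert (Hc : is_RInt (fun x => dphi x * f (phi x)) (psi y) (psi z)
                   (RInt f (phi (psi y)) (phi (psi z)))).
    { apply (is_RInt_comp (V := R_CompleteNormedModule)); intros; auto. }
    rewrite Ey, Ez in Hc.
    replace v with (RInt f y z)
      by (rewrite <- (is_RInt_unique (V := R_CompleteNormedModule) _ _ _ _ Hv); symmetry; now apply (is_RInt_unique (V := R_CompleteNormedModule))).
    apply (RInt_correct (V := R_CompleteNormedModule)).
    apply (ex_RInt_continuous (V := R_CompleteNormedModule)).
    intros w Hw. rewrite <- Ey, <- Ez in Hw.
    (* By the intermediate value theorem every point between [y] and [z] is a value of [phi], so [f]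
       is continuous there. *)
    destruct (IVT_gen phi (psi y) (psi z) w) as [x [_ <-]]; [|exact Hw|apply Cf].
    intros x. apply continuity_pt_filterlim.
    apply (ex_derive_continuous (V := R_NormedModule)). exists (dphi x); apply Dphi.
Qed.

(** Continuity is bundled with convergence so that every integral over a bounded interval exists
    without side conditions. *)
Definition line_integral (g : R -> R) (l : R) : Prop :=
  (forall x, continuous g x) /\
  is_RInt_gen g (Rbar_locally m_infty) (Rbar_locally p_infty) l.

Lemma line_integral_ext (f g : R -> R) (l : R) :
  (forall x, f x = g x) -> line_integral f l -> line_integral g l.
Proof.
  intros E [Cf Hf]. split.
  - intros x. now apply continuous_ext with f.
  - revert Hf. apply is_RInt_gen_ext. apply filter_forall. intros; apply E.
Qed.

Lemma line_integral_scal (f : R -> R) (c l : R) :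
  line_integral f l -> line_integral (fun x => c * f x) (c * l).
Proof.
  intros [Cf Hf]. split.
  - intros x. apply (continuous_scal_r (V := R_NormedModule) c f), Cf.
  - now apply (is_RInt_gen_scal (V := R_NormedModule)
      (Fa := Rbar_locally m_infty) (Fb := Rbar_locally p_infty)).
Qed.

Lemma line_integral_plus (f g : R -> R) (lf lg : R) :
  line_integral f lf -> line_integral g lg ->
  line_integral (fun x => f x + g x) (lf + lg).
Proof.
  intros [Cf Hf] [Cg Hg]. split.
  - intros x. now apply (continuous_plus (V := R_NormedModule) f g).
  - now apply (is_RInt_gen_plus (V := R_NormedModule)
      (Fa := Rbar_locally m_infty) (Fb := Rbar_locally p_infty)).
Qed.

Lemma line_integral_lin (f g : R -> R) (c d lf lg : R) :
  line_integral f lf -> line_integral g lg ->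
  line_integral (fun x => c * f x + d * g x) (c * lf + d * lg).
Proof. intros Hf Hg. apply line_integral_plus; now apply line_integral_scal. Qed.

Lemma line_integral_opp_arg (g : R -> R) (l : R) :
  line_integral g l -> line_integral (fun x => g (- x)) l.
Proof.
  intros [Cg Hl].
  assert (Cg' : forall x, continuous (fun x => g (- x)) x).
  { intros x. apply continuous_comp; [|apply Cg].
    apply (continuous_opp (V := R_NormedModule)), continuous_id. }
  split; [exact Cg' |].
  apply (is_RInt_gen_subst (fun x => g (- x)) Ropp (fun _ => -1) Ropp
           (Rbar_locally p_infty) (Rbar_locally m_infty)).
  - apply Rbar_locally_filter.
  - apply Rbar_locally_filter.
  - intros x. auto_derive; [exact I | ring].
  - intros x. apply continuous_const.
  - intros x. apply Cg'.
  - apply (filterlim_Rbar_opp m_infty).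
  - apply (filterlim_Rbar_opp p_infty).
  - apply filter_forall. intros; ring.
  - apply filter_forall. intros; ring.
  (* The factor -1 from the derivative of [Ropp] cancels the sign from exchanging the two ends. *)
  - apply is_RInt_gen_ext with (fun x => opp (g x)).
    + apply filter_forall. intros ab x _. rewrite Ropp_involutive. unfold opp; simpl; ring.
    + replace l with (opp (opp l)) by (unfold opp; simpl; ring).
      apply (is_RInt_gen_opp (V := R_NormedModule)
        (Fa := Rbar_locally p_infty) (Fb := Rbar_locally m_infty)).
      now apply (is_RInt_gen_swap (V := R_NormedModule)
        (Fa := Rbar_locally p_infty) (Fb := Rbar_locally m_infty)).
Qed.

Lemma line_integral_unique (f : R -> R) (l l' : R) :
  line_integral f l -> line_integral f l' -> l = l'.
Proof.
  intros [_ H] [_ H'].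
  now rewrite <- (is_RInt_gen_unique (V := R_CompleteNormedModule) _ _ H),
    <- (is_RInt_gen_unique (V := R_CompleteNormedModule) _ _ H').
Qed.

(** The thresholds 0 and 1 make the interval contain [0, 1], which serves as a fixed reference piece
    for strict positivity. *)
Lemma line_ordered (P : R * R -> Prop) :
  (forall a b, a <= 0 -> 1 <= b -> P (a, b)) ->
  filter_prod (Rbar_locally m_infty) (Rbar_locally p_infty) P.
Proof.
  intros HP. apply Filter_prod with (fun a => a <= 0) (fun b => 1 <= b).
  - exists 0. intros; lra.
  - exists 1. intros; lra.
  - exact HP.
Qed.

Lemma line_integral_ge0 (g : R -> R) (l : R) :
  (forall x, 0 <= g x) -> line_integral g l -> 0 <= l.
Proof.
  intros Hg [Cg Hl]. revert Hl. apply is_RInt_gen_ge; try typeclasses eauto.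
  apply line_ordered. intros a b Ha Hb; simpl.
  apply RInt_ge_0; [lra | now apply ex_RInt_cont | intros; apply Hg].
Qed.

(** Strict inequalities are lost in the limit, so the bound passed to the limit is the fixed
    positive number [RInt g 0 1]. *)
Lemma line_integral_gt0 (g : R -> R) (l : R) :
  (forall x, 0 < g x) -> line_integral g l -> 0 < l.
Proof.
  intros Hg [Cg Hl].
  assert (Hpos : 0 < RInt g 0 1) by (apply RInt_gt_0; intros; auto; lra).
  apply Rlt_le_trans with (1 := Hpos).
  revert Hl. apply is_RInt_gen_ge; try typeclasses eauto.
  apply line_ordered. intros a b Ha Hb; simpl.
  rewrite <- (RInt_Chasles (V := R_CompleteNormedModule) g a 0 b)
    by now apply ex_RInt_cont.
  rewrite <- (RInt_Chasles (V := R_CompleteNormedModule) g 0 1 b)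
    by now apply ex_RInt_cont.
  unfold plus; simpl.
  assert (0 <= RInt g a 0)
    by (apply RInt_ge_0; [lra | now apply ex_RInt_cont | intros; now apply Rlt_le]).
  assert (0 <= RInt g 1 b)
    by (apply RInt_ge_0; [lra | now apply ex_RInt_cont | intros; now apply Rlt_le]).
  lra.
Qed.
(** * Functions of exponential decay *)

Lemma exp_le (x y : R) : x <= y -> exp x <= exp y.
Proof. intros [H | ->]; [now apply Rlt_le, exp_increasing | apply Rle_refl]. Qed.

(** After a logarithmic change of variable the Beta and Gamma integrands belong to this class, which
    is closed under multiplication by the variable. *)
Definition exp_decay (g : R -> R) : Prop :=
  (forall x, continuous g x) /\
  exists C d, 0 < d /\ forall x, Rabs (g x) <= C * exp (- d * Rabs x).

(** Asking only that [Rabs x] becomes large along [F] treats both infinities at once. *)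
Lemma filterlim_exp_decay (F : (R -> Prop) -> Prop) (f : R -> R) (l C d : R) :
  Filter F -> (forall M, F (fun x => M < Rabs x)) -> 0 < d ->
  F (fun x => Rabs (f x - l) <= C * exp (- d * Rabs x)) ->
  filterlim f F (locally l).
Proof.
  intros FF HF Hd Hf. apply filterlim_locally. intros eps.
  pose proof (cond_pos eps) as He.
  assert (HC : 0 < Rabs C + 1) by (pose proof (Rabs_pos C); lra).
  (* The [+ 1] keeps the denominator positive when [C = 0]; beyond [- ln e / d] the exponential
     factor is below [e]. *)
  pose (e := eps / (Rabs C + 1)).
  assert (He' : 0 < e) by now apply Rdiv_lt_0_compat.
  generalize (filter_and _ _ Hf (HF (- ln e / d))).
  apply filter_imp. intros x [H1 H2].
  change (Rabs (f x - l) < eps).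
  assert (Hexp : exp (- d * Rabs x) < e).
  { rewrite <- (exp_ln e He'). apply exp_increasing.
    apply (Rmult_lt_compat_l d) in H2; [|exact Hd].
    replace (d * (- ln e / d)) with (- ln e) in H2 by (field; lra). lra. }
  apply Rle_lt_trans with (1 := H1).
  pose proof (exp_pos (- d * Rabs x)).
  apply Rle_lt_trans with (Rabs C * exp (- d * Rabs x)).
  { apply Rmult_le_compat_r; [lra | apply Rle_abs]. }
  replace (pos eps) with ((Rabs C + 1) * e) by (unfold e; field; lra).
  pose proof (Rabs_pos C). nra.
Qed.

Lemma m_infty_abs_large (M : R) : Rbar_locally m_infty (fun x => M < Rabs x).
Proof.
  exists (- Rabs M). intros x Hx. pose proof (Rle_abs M). pose proof (Rabs_pos M).
  rewrite Rabs_left by lra. lra.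
Qed.

Lemma p_infty_abs_large (M : R) : Rbar_locally p_infty (fun x => M < Rabs x).
Proof. exists M. intros x Hx. apply Rlt_le_trans with (1 := Hx), Rle_abs. Qed.

(** The boundary terms vanish by decay. All recurrences for the Beta and Gamma integrals by
    integration by parts rest on this. *)
Lemma line_integral_FTC (F f : R -> R) :
  exp_decay F -> (forall x, is_derive F x (f x)) -> (forall x, continuous f x) ->
  line_integral f 0.
Proof.
  intros [_ [C [d [Hd HF]]]] DF Cf. split; [exact Cf |].
  apply is_RInt_gen_ext with (Derive F).
  { apply filter_forall. intros ab x _. apply is_derive_unique, DF. }
  replace 0 with (0 - 0) by ring.
  apply is_RInt_gen_Derive.
  - apply filter_forall. intros ab x _. exists (f x). apply DF.
  - apply filter_forall. intros ab x _. apply continuous_ext with f; [|apply Cf].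
    intros y. symmetry. apply is_derive_unique, DF.
  - apply filterlim_exp_decay with C d;
      [typeclasses eauto | apply m_infty_abs_large | exact Hd |].
    apply filter_forall. intros x. rewrite Rminus_0_r. apply HF.
  - apply filterlim_exp_decay with C d;
      [typeclasses eauto | apply p_infty_abs_large | exact Hd |].
    apply filter_forall. intros x. rewrite Rminus_0_r. apply HF.
Qed.

(* Compare with the logistic function [- (4 C / d) / (1 + exp (d x))]. *)
Lemma exp_decay_integrable (g : R -> R) :
  exp_decay g -> exists l, line_integral g l.
Proof.
  intros [Cg [C [d [Hd Hg]]]].
  assert (HC : 0 <= C).
  { pose proof (Hg 0) as H0. rewrite Rabs_R0, Rmult_0_r, exp_0 in H0.
    pose proof (Rabs_pos (g 0)). lra. }
  cut (ex_RInt_gen g (Rbar_locally m_infty) (Rbar_locally p_infty)).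
  { intros [l Hl]. now exists l. }
  set (A := 4 * C / d).
  assert (HA : 0 <= A) by (apply Rdiv_le_0_compat; lra).
  assert (Hpos : forall x, 0 < exp (d * x)) by (intros; apply exp_pos).
  apply (ex_RInt_gen_dominated _ _ g (fun x => - (A / (1 + exp (d * x))))
    (fun x => 4 * C * (exp (d * x) / (1 + exp (d * x)) ^ 2)) (- A) 0).
  - typeclasses eauto.
  - typeclasses eauto.
  - exact Cg.
  - intros x. apply (ex_derive_continuous (V := R_NormedModule)).
    auto_derive. specialize (Hpos x). nra.
  - intros x. specialize (Hpos x). auto_derive; [lra |].
    unfold A. field. lra.
  - intros x. apply Rle_trans with (1 := Hg x).
    rewrite Rmult_comm, (Rmult_comm 4 C), Rmult_assoc, Rmult_comm.
    apply Rmult_le_compat_l; [exact HC |].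
    specialize (Hpos x). set (q := exp (d * x)) in *.
    (* Here [exp (- d * Rabs x)] is the smaller of [q] and [/ q], while [(1 + q) ^ 2] is at most 4
       for [q < 1] and at most [4 * q ^ 2] for [q >= 1]. *)
    apply Rmult_le_reg_r with ((1 + q) ^ 2); [nra |].
    replace (4 * (q / (1 + q) ^ 2) * (1 + q) ^ 2) with (4 * q) by (field; lra).
    unfold Rabs; destruct (Rcase_abs x) as [Hx | Hx].
    + replace (- d * - x) with (d * x) by ring. fold q.
      assert (q < 1) by (unfold q; rewrite <- exp_0; apply exp_increasing; nra).
      nra.
    + replace (- d * x) with (- (d * x)) by ring. rewrite exp_Ropp. fold q.
      assert (1 <= q).
      { unfold q. pose proof (exp_ineq1_le (d * x)). nra. }
      apply Rmult_le_reg_l with q; [lra |].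
      replace (q * (/ q * (1 + q) ^ 2)) with ((1 + q) ^ 2) by (field; lra). nra.
  - apply filterlim_exp_decay with A d;
      [typeclasses eauto | apply m_infty_abs_large | exact Hd |].
    exists 0. intros x Hx. rewrite (Rabs_left x) by lra.
    replace (- d * - x) with (d * x) by ring.
    specialize (Hpos x). set (q := exp (d * x)) in *.
    replace (- (A / (1 + q)) - - A) with (A * (q / (1 + q))) by (field; lra).
    assert (0 < q / (1 + q)) by (apply Rdiv_lt_0_compat; lra).
    rewrite Rabs_pos_eq by nra. apply Rmult_le_compat_l; [lra |].
    apply Rmult_le_reg_r with (1 + q); [lra |].
    replace (q / (1 + q) * (1 + q)) with q by (field; lra). nra.
  - apply filterlim_exp_decay with A d;
      [typeclasses eauto | apply p_infty_abs_large | exact Hd |].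
    exists 0. intros x Hx. rewrite (Rabs_pos_eq x) by lra.
    replace (- d * x) with (- (d * x)) by ring. rewrite exp_Ropp.
    specialize (Hpos x). set (q := exp (d * x)) in *.
    rewrite Rminus_0_r, Rabs_Ropp.
    assert (0 < / (1 + q)) by (apply Rinv_0_lt_compat; lra).
    rewrite Rabs_pos_eq by (unfold Rdiv; nra).
    unfold Rdiv. apply Rmult_le_compat_l; [lra |]. apply Rinv_le_contravar; lra.
Qed.

Lemma exp_decay_RInt_gen (g : R -> R) :
  exp_decay g ->
  line_integral g (RInt_gen g (Rbar_locally m_infty) (Rbar_locally p_infty)).
Proof.
  intros Hg. destruct (exp_decay_integrable g Hg) as [l Hl].
  now rewrite (is_RInt_gen_unique (V := R_CompleteNormedModule) _ _ (proj2 Hl)).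
Qed.

(** Half of the decay rate pays for the factor: [d / 2 * Rabs x <= exp (d / 2 * Rabs x)]. *)
Lemma exp_decay_mul_id (g : R -> R) : exp_decay g -> exp_decay (fun x => x * g x).
Proof.
  intros [Cg [C [d [Hd Hg]]]]. split.
  - intros x. apply (continuous_mult (K := R_AbsRing)); [apply continuous_id | apply Cg].
  - exists (2 / d * C), (d / 2). split; [lra |]. intros x.
    rewrite Rabs_mult.
    pose proof (Rabs_pos x) as Hx. pose proof (Rabs_pos (g x)) as Hgx.
    pose proof (exp_ineq1_le (d / 2 * Rabs x)) as Hexp.
    assert (H1 : Rabs x <= 2 / d * exp (d / 2 * Rabs x)).
    { apply Rmult_le_reg_l with (d / 2); [lra |].
      replace (d / 2 * (2 / d * exp (d / 2 * Rabs x))) with (exp (d / 2 * Rabs x))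
        by (field; lra). lra. }
    apply Rle_trans with (2 / d * exp (d / 2 * Rabs x) * (C * exp (- d * Rabs x))).
    { apply Rmult_le_compat; auto. }
    right. replace (- (d / 2) * Rabs x) with (d / 2 * Rabs x + - d * Rabs x) by field.
    rewrite exp_plus. ring.
Qed.

(** Multiplying [1 - z <= exp (- z)] by [exp z] gives [exp z - 1 <= z * exp z], hence the remainder
    is at most [z * (exp z - 1)]; the sign of [z] decides how this is bounded. *)
Lemma exp_taylor1 (z : R) : 0 <= exp z - 1 - z <= z ^ 2 * exp (Rabs z).
Proof.
  pose proof (exp_ineq1_le z) as H1. pose proof (exp_ineq1_le (- z)) as H2.
  pose proof (exp_pos z) as H0.
  assert (H3 : exp z * exp (- z) = 1) by (rewrite <- exp_plus, Rplus_opp_r; apply exp_0).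
  split; [lra |].
  assert (H4 : exp z - 1 - z <= z * (exp z - 1)) by nra.
  apply Rle_trans with (1 := H4).
  unfold Rabs; destruct (Rcase_abs z).
  - assert (1 <= exp (- z)) by lra. nra.
  - assert (exp z - 1 <= z * exp z) by nra. nra.
Qed.

(** Differentiation under the integral sign through an explicit remainder: [exp_taylor1] at [h * t]
    bounds the error by [h ^ 2 * K] with [K] independent of [h]. *)
Lemma is_derive_laplace (w Phi : R -> R) (x eta N : R) :
  0 < eta -> exp_decay (fun t => exp (x * t) * w t) ->
  (forall h, Rabs h < eta ->
    line_integral (fun t => exp ((x + h) * t) * w t) (Phi (x + h))) ->
  line_integral (fun t => t * (exp (x * t) * w t)) N ->
  is_derive Phi x N.
Proof.
  intros Heta Hw HPhi HN.
  destruct (Hw) as [Cg [C [d [Hd Hg]]]].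
  (* This dominates the remainder divided by [h ^ 2]. Only half of the rate [d] is left, the other
     half absorbs [exp (Rabs (h * t))] for [Rabs h < d / 2]. *)
  assert (HB : exp_decay (fun t => t * (t * (C * exp (- (d / 2) * Rabs t))))).
  { apply (exp_decay_mul_id (fun t => t * (C * exp (- (d / 2) * Rabs t)))).
    apply (exp_decay_mul_id (fun t => C * exp (- (d / 2) * Rabs t))).
    split.
    - intros t. apply (continuous_scal_r (V := R_NormedModule)).
      apply continuous_comp; [|apply continuous_exp].
      apply (continuous_scal_r (V := R_NormedModule)).
      apply continuous_Rabs.
    - exists (Rabs C), (d / 2). split; [lra |]. intros t.
      rewrite Rabs_mult, (Rabs_pos_eq (exp _)) by apply Rlt_le, exp_pos. lra. }
  destruct (exp_decay_integrable _ HB) as [K HK].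
  assert (HK0 : 0 <= K).
  { revert HK. apply line_integral_ge0.
    intros t. pose proof (Rle_trans _ _ _ (Rabs_pos _) (Hg 0)) as HC.
    rewrite Rabs_R0, Rmult_0_r, exp_0 in HC.
    pose proof (exp_pos (- (d / 2) * Rabs t)). rewrite <- Rmult_assoc.
    apply Rmult_le_pos; nra. }
  assert (Hrem : forall h, Rabs h < eta -> Rabs h < d / 2 ->
    Rabs (Phi (x + h) - Phi x - h * N) <= h ^ 2 * K).
  { intros h Hh1 Hh2.
    assert (H0 : line_integral (fun t => exp (x * t) * w t) (Phi x)).
    { replace (Phi x) with (Phi (x + 0)) by (f_equal; ring).
      apply line_integral_ext with (fun t => exp ((x + 0) * t) * w t).
      - intros t. now rewrite Rplus_0_r.
      - apply HPhi. now rewrite Rabs_R0. }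
    pose proof (line_integral_lin _ _ 1 (-1) _ _ (HPhi h Hh1)
                  (line_integral_lin _ _ 1 h _ _ H0 HN)) as HR.
    assert (Hpt : forall t, Rabs (exp ((x + h) * t) * w t - exp (x * t) * w t
                      - h * (t * (exp (x * t) * w t)))
                    <= h ^ 2 * (t * (t * (C * exp (- (d / 2) * Rabs t))))).
    { intros t.
      replace (exp ((x + h) * t) * w t - exp (x * t) * w t - h * (t * (exp (x * t) * w t)))
        with ((exp (h * t) - 1 - h * t) * (exp (x * t) * w t))
        by (rewrite Rmult_plus_distr_r, exp_plus; ring).
      rewrite Rabs_mult.
      destruct (exp_taylor1 (h * t)) as [T1 T2].
      rewrite (Rabs_pos_eq _ T1).
      apply Rle_trans with ((h * t) ^ 2 * exp (Rabs (h * t)) * (C * exp (- d * Rabs t))).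
      { apply Rmult_le_compat; auto. apply Rabs_pos. }
      apply Rle_trans with ((h * t) ^ 2 * exp (d / 2 * Rabs t) * (C * exp (- d * Rabs t))).
      { apply Rmult_le_compat_r; [apply Rle_trans with (2 := Hg t), Rabs_pos |].
        apply Rmult_le_compat_l; [apply pow2_ge_0 |].
        apply exp_le. rewrite Rabs_mult.
        apply Rmult_le_compat_r; [apply Rabs_pos | lra]. }
      right. replace (- (d / 2) * Rabs t) with (d / 2 * Rabs t + - d * Rabs t) by field.
      rewrite exp_plus. ring. }
    assert (HhK : line_integral (fun t => h ^ 2 * (t * (t * (C * exp (- (d / 2) * Rabs t)))))
                    (h ^ 2 * K)).
    { exact (line_integral_scal _ (h ^ 2) _ HK). }
    apply Rabs_le. split.
    - pose proof (line_integral_lin _ _ 1 1 _ _ HhK HR) as Hs.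
      apply line_integral_ge0 in Hs; [lra |].
      intros t. specialize (Hpt t). apply Rabs_le_between in Hpt. lra.
    - pose proof (line_integral_lin _ _ 1 (-1) _ _ HhK HR) as Hs.
      apply line_integral_ge0 in Hs; [lra |].
      intros t. specialize (Hpt t). apply Rabs_le_between in Hpt. lra. }
  apply is_derive_Reals. intros eps Heps.
  (* The last bound gives [h ^ 2 * K < eps * Rabs h]; the [+ 1] covers [K = 0]. *)
  assert (Hdelta : 0 < Rmin (Rmin eta (d / 2)) (eps / (K + 1))).
  { repeat apply Rmin_glb_lt; [lra | lra | apply Rdiv_lt_0_compat; lra]. }
  exists (mkposreal _ Hdelta). intros h Hh0 Hh; simpl in Hh.
  assert (Hh1 : Rabs h < eta).
  { apply Rlt_le_trans with (1 := Hh). eapply Rle_trans; apply Rmin_l. }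
  assert (Hh2 : Rabs h < d / 2).
  { apply Rlt_le_trans with (1 := Hh). eapply Rle_trans; [apply Rmin_l | apply Rmin_r]. }
  assert (Hh3 : Rabs h < eps / (K + 1)).
  { apply Rlt_le_trans with (1 := Hh). apply Rmin_r. }
  specialize (Hrem h Hh1 Hh2).
  replace ((Phi (x + h) - Phi x) / h - N) with ((Phi (x + h) - Phi x - h * N) / h)
    by (field; exact Hh0).
  unfold Rdiv. rewrite Rabs_mult, Rabs_inv.
  pose proof (Rabs_pos_lt h Hh0) as Hp.
  apply Rmult_lt_reg_r with (Rabs h); [exact Hp |].
  rewrite Rmult_assoc, Rinv_l, Rmult_1_r by lra.
  apply Rle_lt_trans with (1 := Hrem).
  rewrite <- pow2_abs. simpl. rewrite Rmult_1_r.
  rewrite (Rmult_comm eps), Rmult_assoc. apply Rmult_lt_compat_l; [exact Hp |].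
  apply (Rmult_lt_compat_r (K + 1)) in Hh3; [|lra].
  replace (eps / (K + 1) * (K + 1)) with eps in Hh3 by (field; lra). nra.
Qed.

(* With [c = N / M] the tilted integral of [t - c] is at least [exp (h c) (N - c M) = 0],
   because [(t - c) (exp (h t) - exp (h c)) >= 0]. *)
Lemma tilted_mean_le (w : R -> R) (x h M N M' N' : R) :
  0 <= h -> (forall t, 0 < w t) ->
  line_integral (fun t => exp (x * t) * w t) M ->
  line_integral (fun t => t * (exp (x * t) * w t)) N ->
  line_integral (fun t => exp ((x + h) * t) * w t) M' ->
  line_integral (fun t => t * (exp ((x + h) * t) * w t)) N' ->
  N / M <= N' / M'.
Proof.
  intros Hh Hw HM HN HM' HN'.
  assert (Pe : forall y t, 0 < exp (y * t) * w t).
  { intros y t. apply Rmult_lt_0_compat; [apply exp_pos | apply Hw]. }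
  pose proof (line_integral_gt0 _ _ (Pe x) HM) as PM.
  pose proof (line_integral_gt0 _ _ (Pe (x + h)) HM') as PM'.
  set (c := N / M).
  pose proof (line_integral_lin _ _ 1 (- c) _ _ HN HM) as H1.
  pose proof (line_integral_lin _ _ 1 (- c) _ _ HN' HM') as H2.
  pose proof (line_integral_lin _ _ 1 (- exp (h * c)) _ _ H2 H1) as H3.
  apply line_integral_ge0 in H3.
  - replace (1 * N + - c * M) with 0 in H3 by (unfold c; field; lra).
    apply Rmult_le_reg_r with M'; [exact PM' |].
    replace (N' / M' * M') with N' by (field; lra). lra.
  - intros t.
    replace (exp ((x + h) * t)) with (exp (h * t) * exp (x * t))
      by (rewrite <- exp_plus; f_equal; ring).
    replace (1 * (1 * (t * (exp (h * t) * exp (x * t) * w t)) +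
        - c * (exp (h * t) * exp (x * t) * w t)) +
        - exp (h * c) * (1 * (t * (exp (x * t) * w t)) + - c * (exp (x * t) * w t)))
      with ((t - c) * (exp (h * t) - exp (h * c)) * (exp (x * t) * w t)) by ring.
    apply Rmult_le_pos; [|apply Rlt_le, Pe].
    destruct (Rle_dec c t) as [Hct | Hct].
    + assert (exp (h * c) <= exp (h * t)) by (apply exp_le; nra). nra.
    + assert (exp (h * t) <= exp (h * c)) by (apply exp_le; nra). nra.
Qed.
(** * Digamma differences *)

(** These properties determine [Psi b - Psi a] for positive arguments. The last one is monotonicity
    along a line of constant sum: [(a + h, b)] and [(a, b + h)] both add up to [a + b + h]. *)
Definition digamma_gap (L : R -> R -> R) : Prop :=
  (forall a b, 0 < a -> 0 < b -> L a (b + 1) = L a b + / b) /\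
  (forall a b, 0 < a -> 0 < b -> L (a + 1) b = L a b - / a) /\
  (forall a, 0 < a -> L a a = 0) /\
  (forall a b h, 0 < a -> 0 < b -> 0 <= h -> L (a + h) b <= L a (b + h)).

(** On the line of sum [a + b] the point [(a, b)] lies between [(c + k, c)] and [(c, c + k)], where
    [c = (a + b - k) / 2]. Each of these is [k] recurrence steps from the diagonal, where [L] is 0,
    and a step changes [L] by at most [/ c]. *)
Lemma digamma_gap_bound (L : R -> R -> R) (a b : R) (k : nat) :
  digamma_gap L -> 0 < a -> 0 < b -> 0 < a + b - INR k -> Rabs (b - a) <= INR k ->
  Rabs (L a b) <= INR k / ((a + b - INR k) / 2).
Proof.
  intros [Hr [Hl [H0 Hm]]] Ha Hb Hk Hab.
  apply Rabs_le_between in Hab.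
  set (c := (a + b - INR k) / 2).
  assert (Hc : 0 < c) by (unfold c; lra).
  assert (Hup : forall j : nat, L c (c + INR j) <= INR j / c).
  { intros j. induction j as [|j IH].
    - simpl. rewrite Rplus_0_r, H0 by exact Hc. unfold Rdiv. lra.
    - pose proof (pos_INR j). rewrite S_INR, <- Rplus_assoc, Hr by lra.
      assert (/ (c + INR j) <= / c) by (apply Rinv_le_contravar; lra).
      unfold Rdiv in *. lra. }
  assert (Hlow : forall j : nat, - (INR j / c) <= L (c + INR j) c).
  { intros j. induction j as [|j IH].
    - simpl. rewrite Rplus_0_r, H0 by exact Hc. unfold Rdiv. lra.
    - pose proof (pos_INR j). rewrite S_INR, <- Rplus_assoc, Hl by lra.
      assert (/ (c + INR j) <= / c) by (apply Rinv_le_contravar; lra).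
      unfold Rdiv in *. lra. }
  apply Rabs_le. split.
  - apply Rle_trans with (1 := Hlow k).
    pose proof (Hm a c (b - c)) as H.
    replace (a + (b - c)) with (c + INR k) in H by (unfold c; field).
    replace (c + (b - c)) with b in H by ring.
    apply H; unfold c; lra.
  - apply Rle_trans with (2 := Hup k).
    pose proof (Hm c b (a - c)) as H.
    replace (c + (a - c)) with a in H by ring.
    replace (b + (a - c)) with (c + INR k) in H by (unfold c; field).
    apply H; unfold c; lra.
Qed.

Lemma digamma_gap_unique (L L' : R -> R -> R) (a b : R) :
  digamma_gap L -> digamma_gap L' -> 0 < a -> 0 < b -> L a b = L' a b.
Proof.
  intros HL HL' Ha Hb.
  set (D := L a b - L' a b).
  assert (HD : forall m : nat, L (a + INR m) (b + INR m) - L' (a + INR m) (b + INR m) = D).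
  { intros m. induction m as [|m IH].
    - simpl. now rewrite !Rplus_0_r.
    - destruct HL as [Hr [Hl _]], HL' as [Hr' [Hl' _]].
      pose proof (pos_INR m). rewrite S_INR, <- !Rplus_assoc.
      rewrite Hr, Hl, Hr', Hl' by lra. lra. }
  (* The inequality is strict, so [k] is positive even when [a = b]. *)
  destruct (INR_unbounded (Rabs (b - a))) as [k Hk].
  pose proof (Rabs_pos (b - a)) as Hba.
  destruct (Req_dec D 0) as [E | NE]; [unfold D in E; lra | exfalso].
  pose proof (Rabs_pos_lt D NE) as HDpos.
  (* At the point shifted by [m] both gaps are at most [k / c] with [c > m - k / 2], so this choice
     forces [2 * k / c < Rabs D]. *)
  destruct (INR_unbounded (INR k + 2 * INR k / Rabs D)) as [m Hm].
  assert (Hq : 0 < 2 * INR k / Rabs D) by (apply Rdiv_lt_0_compat; lra).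
  assert (Hab : forall p, Rabs (b + p - (a + p)) <= INR k).
  { intros p. replace (b + p - (a + p)) with (b - a) by ring. lra. }
  pose proof (digamma_gap_bound L (a + INR m) (b + INR m) k HL
    ltac:(lra) ltac:(lra) ltac:(lra) (Hab _)) as B.
  pose proof (digamma_gap_bound L' (a + INR m) (b + INR m) k HL'
    ltac:(lra) ltac:(lra) ltac:(lra) (Hab _)) as B'.
  set (c := (a + INR m + (b + INR m) - INR k) / 2) in *.
  assert (Hc : 2 * INR k / Rabs D < c) by (unfold c; lra).
  assert (Hc0 : 0 < c) by lra.
  assert (HDle : Rabs D <= 2 * (INR k / c)).
  { rewrite <- (HD m).
    apply Rabs_le_between in B; apply Rabs_le_between in B'. apply Rabs_le. lra. }
  apply (Rmult_lt_compat_r (Rabs D)) in Hc; [|exact HDpos].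
  replace (2 * INR k / Rabs D * Rabs D) with (2 * INR k) in Hc by (field; lra).
  apply (Rmult_le_compat_l c) in HDle; [|lra].
  replace (c * (2 * (INR k / c))) with (2 * INR k) in HDle by (field; lra). lra.
Qed.

Lemma is_derive_id_mult (f : R -> R) (x l : R) :
  is_derive f x l -> is_derive (fun y => y * f y) x (1 * f x + x * l).
Proof.
  intros Hf. auto_derive; [now exists l |].
  replace (Derive _ x) with l by (symmetry; now apply is_derive_unique). ring.
Qed.

(** This is the integrand of [Gamma x] in the variable [t = ln u]. On the left [exp (x * t)] gives
    the rate [x]; on the right [exp (- exp t)] decays faster, and the constant absorbs the growth of
    [exp (2 * x * t)]. *)
Lemma exp_decay_gamma_kernel (x : R) :
  0 < x -> exp_decay (fun t => exp (x * t) * exp (- exp t)).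
Proof.
  intros Hx. split.
  - intros t. apply (ex_derive_continuous (V := R_NormedModule)). auto_derive. exact I.
  - exists (exp (4 * x ^ 2)), x. split; [exact Hx |]. intros t.
    rewrite <- !exp_plus, Rabs_pos_eq by apply Rlt_le, exp_pos.
    apply exp_le. pose proof (exp_pos t).
    unfold Rabs; destruct (Rcase_abs t) as [Ht | Ht]; [nra |].
    (* [2 x t - exp t <= 2 x t - t^2 / 4 <= 4 x^2] *)
    pose proof (exp_ineq1_le (t / 2)).
    assert (exp t = exp (t / 2) * exp (t / 2)) by (rewrite <- exp_plus; f_equal; field).
    assert (t ^ 2 / 4 <= exp t) by nra.
    pose proof (pow2_ge_0 (t / 2 - 2 * x)). nra.
Qed.

(** * The Beta integral *)

(** The power [(1 + exp t)^(-s)]. Since [beta_kernel] takes [s = a + b], moving along a line of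
    constant sum changes only the exponential tilt [exp (b * t)], as [tilted_mean_le] requires. *)
Definition logistic_weight (s t : R) : R := exp (- s * ln (1 + exp t)).

(* The integrand of [Beta a b] in the variable [t] with argument [1 / (1 + exp t)]. *)
Definition beta_kernel (a b t : R) : R := exp (b * t) * logistic_weight (a + b) t.

Lemma logistic_weight_S (s t : R) :
  logistic_weight (s + 1) t * (1 + exp t) = logistic_weight s t.
Proof.
  pose proof (exp_pos t).
  unfold logistic_weight. rewrite <- (exp_ln (1 + exp t)) at 2 by lra.
  rewrite <- exp_plus. f_equal. ring.
Qed.

(** From [1 + exp (- t) = exp (- t) * (1 + exp t)]. *)
Lemma beta_kernel_opp (a b t : R) : beta_kernel a b (- t) = beta_kernel b a t.
Proof.
  pose proof (exp_pos t).
  unfold beta_kernel, logistic_weight. rewrite <- !exp_plus. f_equal.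
  replace (1 + exp (- t)) with (exp (- t) * (1 + exp t))
    by (rewrite Rmult_plus_distr_l, <- exp_plus, Rplus_opp_l, exp_0; ring).
  rewrite ln_mult, ln_exp by (try apply exp_pos; lra). rewrite (Rplus_comm b a). ring.
Qed.

(** The weights [1 / (1 + exp t)] and [exp t / (1 + exp t)] add up to 1; the first raises [a], the
    second raises [b]. *)
Lemma beta_kernel_split (a b t : R) :
  beta_kernel a b t = beta_kernel (a + 1) b t + beta_kernel a (b + 1) t.
Proof.
  unfold beta_kernel. rewrite <- (logistic_weight_S (a + b)).
  replace (a + 1 + b) with (a + b + 1) by ring.
  replace (a + (b + 1)) with (a + b + 1) by ring.
  replace ((b + 1) * t) with (b * t + t) by ring. rewrite exp_plus. ring.
Qed.

Lemma is_derive_beta_kernel (a b t : R) :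
  is_derive (beta_kernel a b) t (b * beta_kernel a b t - (a + b) * beta_kernel a (b + 1) t).
Proof.
  pose proof (exp_pos t).
  unfold beta_kernel. replace (a + (b + 1)) with (a + b + 1) by ring.
  pose proof (logistic_weight_S (a + b) t) as E.
  unfold logistic_weight in *. auto_derive; [lra |].
  replace ((b + 1) * t) with (b * t + t) by ring. rewrite <- E, exp_plus. field. lra.
Qed.

(** For [t < 0] the rate [b] comes from [ln (1 + exp t) >= 0], for [t >= 0] the rate [a] comes from
    [ln (1 + exp t) >= t]. *)
Lemma exp_decay_beta_kernel (a b : R) :
  0 < a -> 0 < b -> exp_decay (beta_kernel a b).
Proof.
  intros Ha Hb. split.
  - intros t. apply (ex_derive_continuous (V := R_NormedModule)).
    eexists. apply is_derive_beta_kernel.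
  - exists 1, (Rmin b a). split; [apply Rmin_glb_lt; lra |]. intros t.
    unfold beta_kernel, logistic_weight.
    rewrite <- exp_plus, Rabs_pos_eq by apply Rlt_le, exp_pos.
    rewrite Rmult_1_l. apply exp_le.
    pose proof (Rmin_l b a) as H1. pose proof (Rmin_r b a) as H2.
    set (d := Rmin b a) in *.
    pose proof (exp_pos t) as Ht.
    unfold Rabs; destruct (Rcase_abs t) as [Hn | Hp].
    + assert (0 <= ln (1 + exp t)) by (rewrite <- ln_1; apply ln_le; lra). nra.
    + assert (t <= ln (1 + exp t)) by (rewrite <- (ln_exp t) at 1; apply ln_le; lra). nra.
Qed.

Lemma filterlim_logit_at_right :
  filterlim (fun y => ln (y / (1 - y))) (at_right 0) (Rbar_locally m_infty).
Proof.
  intros P [M HM].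
  (* With [y < 1 / 2] the odds [y / (1 - y)] are below [2 * y], hence below [exp M]. *)
  assert (Hd : 0 < Rmin (1 / 2) (exp M / 2))
    by (apply Rmin_glb_lt; pose proof (exp_pos M); lra).
  exists (mkposreal _ Hd). intros y Hy Hpos. apply HM.
  change (Rabs (y - 0) < Rmin (1 / 2) (exp M / 2)) in Hy.
  rewrite Rminus_0_r, Rabs_pos_eq in Hy by lra.
  pose proof (Rmin_l (1 / 2) (exp M / 2)). pose proof (Rmin_r (1 / 2) (exp M / 2)).
  rewrite <- (ln_exp M). apply ln_increasing; [apply Rdiv_lt_0_compat; lra |].
  apply Rmult_lt_reg_r with (1 - y); [lra |].
  replace (y / (1 - y) * (1 - y)) with (y * 1) by (field; lra). nra.
Qed.

Lemma filterlim_logit_at_left :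
  filterlim (fun y => ln (y / (1 - y))) (at_left 1) (Rbar_locally p_infty).
Proof.
  intros P [M HM].
  (* Now [y > 1 / 2] and [1 - y < exp (- M) / 2], so the odds exceed [exp M]. *)
  assert (Hd : 0 < Rmin (1 / 2) (exp (- M) / 2))
    by (apply Rmin_glb_lt; pose proof (exp_pos (- M)); lra).
  exists (mkposreal _ Hd). intros y Hy Hlt. apply HM.
  change (Rabs (y - 1) < Rmin (1 / 2) (exp (- M) / 2)) in Hy.
  rewrite Rabs_left in Hy by lra.
  pose proof (Rmin_l (1 / 2) (exp (- M) / 2)). pose proof (Rmin_r (1 / 2) (exp (- M) / 2)).
  assert (E : exp M * exp (- M) = 1) by (rewrite <- exp_plus, Rplus_opp_r; apply exp_0).
  pose proof (exp_pos M).
  rewrite <- (ln_exp M). apply ln_increasing; [apply exp_pos |].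
  apply Rmult_lt_reg_r with (1 - y); [lra |].
  replace (y / (1 - y) * (1 - y)) with (y * 1) by (field; lra). nra.
Qed.

Lemma line_integral_Beta (a b : R) :
  0 < a -> 0 < b -> line_integral (beta_kernel a b) (Beta a b).
Proof.
  intros Ha Hb.
  pose proof (exp_decay_RInt_gen _ (exp_decay_beta_kernel a b Ha Hb)) as HI.
  set (l := RInt_gen (beta_kernel a b) _ _) in HI.
  replace (Beta a b) with l; [exact HI |].
  symmetry. unfold Beta. apply is_RInt_gen_unique.
  apply (is_RInt_gen_subst _ (fun t => exp t / (1 + exp t))
    (fun t => exp t / (1 + exp t) ^ 2) (fun y => ln (y / (1 - y)))
    (Rbar_locally m_infty) (Rbar_locally p_infty)).
  - apply filter_filter.
  - apply filter_filter.
  - intros t. pose proof (exp_pos t). auto_derive; [lra | field; lra].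
  - intros t. pose proof (exp_pos t).
    apply (ex_derive_continuous (V := R_NormedModule)). auto_derive. nra.
  - intros t. pose proof (exp_pos t).
    assert (0 < exp t / (1 + exp t)) by (apply Rdiv_lt_0_compat; lra).
    assert (0 < 1 - exp t / (1 + exp t)).
    { replace (1 - exp t / (1 + exp t)) with (/ (1 + exp t)) by (field; lra).
      apply Rinv_0_lt_compat; lra. }
    apply (ex_derive_continuous (V := R_NormedModule)). unfold Rpower. auto_derive. lra.
  - exact filterlim_logit_at_right.
  - exact filterlim_logit_at_left.
  - exists (mkposreal 1 Rlt_0_1). intros y Hy Hpos.
    change (Rabs (y - 0) < 1) in Hy. apply Rabs_def2 in Hy.
    rewrite exp_ln by (apply Rdiv_lt_0_compat; lra). field. lra.
  - exists (mkposreal 1 Rlt_0_1). intros y Hy Hlt.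
    change (Rabs (y - 1) < 1) in Hy. apply Rabs_def2 in Hy.
    rewrite exp_ln by (apply Rdiv_lt_0_compat; lra). field. lra.
  (* The substitution [y = exp t / (1 + exp t)] produces [beta_kernel b a], so the integral is
     reflected first. *)
  - apply line_integral_opp_arg in HI. destruct HI as [_ HI]. revert HI.
    apply is_RInt_gen_ext. apply filter_forall. intros _ t _.
    rewrite beta_kernel_opp. pose proof (exp_pos t).
    unfold beta_kernel, logistic_weight, Rpower.
    replace (1 - exp t / (1 + exp t)) with (/ (1 + exp t)) by (field; lra).
    rewrite ln_div, ln_Rinv, ln_exp by lra.
    replace (exp t / (1 + exp t) ^ 2) with (exp (t - 2 * ln (1 + exp t))).
    { rewrite <- !exp_plus. f_equal. ring. }
    unfold Rminus. rewrite exp_plus, exp_Ropp.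
    replace (2 * ln (1 + exp t)) with (ln (1 + exp t) + ln (1 + exp t)) by ring.
    rewrite exp_plus, exp_ln by lra. field. lra.
Qed.

(** Formally the derivative of [Beta (a - h) (b + h)] at [h = 0]. *)
Definition Beta1 (a b : R) : R :=
  RInt_gen (fun t => t * beta_kernel a b t) (Rbar_locally m_infty) (Rbar_locally p_infty).

Lemma line_integral_Beta1 (a b : R) :
  0 < a -> 0 < b -> line_integral (fun t => t * beta_kernel a b t) (Beta1 a b).
Proof.
  intros Ha Hb.
  apply exp_decay_RInt_gen, exp_decay_mul_id, exp_decay_beta_kernel; assumption.
Qed.

Lemma Beta_pos (a b : R) : 0 < a -> 0 < b -> 0 < Beta a b.
Proof.
  intros Ha Hb. refine (line_integral_gt0 _ _ _ (line_integral_Beta a b Ha Hb)).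
  intros t. apply Rmult_lt_0_compat; apply exp_pos.
Qed.

Lemma Beta_Sr (a b : R) :
  0 < a -> 0 < b -> (a + b) * Beta a (b + 1) = b * Beta a b.
Proof.
  intros Ha Hb.
  pose proof (line_integral_lin _ _ b (- (a + b)) _ _ (line_integral_Beta a b Ha Hb)
    (line_integral_Beta a (b + 1) Ha ltac:(lra))) as H.
  cut (b * Beta a b + - (a + b) * Beta a (b + 1) = 0); [lra |].
  apply (line_integral_unique _ _ _ H).
  apply line_integral_FTC with (beta_kernel a b).
  - now apply exp_decay_beta_kernel.
  - intros t. replace (b * _ + _) with
      (b * beta_kernel a b t - (a + b) * beta_kernel a (b + 1) t) by ring.
    apply is_derive_beta_kernel.
  - exact (proj1 H).
Qed.

(** The derivative of [t * beta_kernel a b t] integrates to 0; the product rule contributes the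
    extra [Beta a b]. *)
Lemma Beta1_Sr (a b : R) :
  0 < a -> 0 < b -> (a + b) * Beta1 a (b + 1) = Beta a b + b * Beta1 a b.
Proof.
  intros Ha Hb.
  pose proof (line_integral_plus _ _ _ _ (line_integral_Beta a b Ha Hb)
    (line_integral_lin _ _ b (- (a + b)) _ _ (line_integral_Beta1 a b Ha Hb)
      (line_integral_Beta1 a (b + 1) Ha ltac:(lra)))) as H.
  cut (Beta a b + (b * Beta1 a b + - (a + b) * Beta1 a (b + 1)) = 0); [lra |].
  apply (line_integral_unique _ _ _ H).
  apply line_integral_FTC with (fun t => t * beta_kernel a b t).
  - now apply exp_decay_mul_id, exp_decay_beta_kernel.
  - intros t. replace (_ + (b * _ + _)) with (1 * beta_kernel a b t +
      t * (b * beta_kernel a b t - (a + b) * beta_kernel a (b + 1) t)) by ring.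
    apply is_derive_id_mult, is_derive_beta_kernel.
  - exact (proj1 H).
Qed.

Lemma Beta_split (a b : R) :
  0 < a -> 0 < b -> Beta a b = Beta (a + 1) b + Beta a (b + 1).
Proof.
  intros Ha Hb.
  apply (line_integral_unique _ _ _ (line_integral_Beta a b Ha Hb)).
  apply line_integral_ext with (fun t => beta_kernel (a + 1) b t + beta_kernel a (b + 1) t).
  - intros t. symmetry. apply beta_kernel_split.
  - apply line_integral_plus; apply line_integral_Beta; lra.
Qed.

Lemma Beta1_split (a b : R) :
  0 < a -> 0 < b -> Beta1 a b = Beta1 (a + 1) b + Beta1 a (b + 1).
Proof.
  intros Ha Hb.
  apply (line_integral_unique _ _ _ (line_integral_Beta1 a b Ha Hb)).
  apply line_integral_ext with
    (fun t => t * beta_kernel (a + 1) b t + t * beta_kernel a (b + 1) t).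
  - intros t. rewrite (beta_kernel_split a b). ring.
  - apply line_integral_plus; apply line_integral_Beta1; lra.
Qed.

(** The integrand is odd. *)
Lemma Beta1_diag (a : R) : 0 < a -> Beta1 a a = 0.
Proof.
  intros Ha. pose proof (line_integral_Beta1 a a Ha Ha) as H.
  pose proof (line_integral_opp_arg _ _ H) as H'.
  apply line_integral_ext with (g := fun t => -1 * (t * beta_kernel a a t)) in H'.
  - pose proof (line_integral_unique _ _ _ H' (line_integral_scal _ (-1) _ H)). lra.
  - intros t. rewrite beta_kernel_opp. ring.
Qed.

Lemma digamma_gap_Beta : digamma_gap (fun a b => Beta1 a b / Beta a b).
Proof.
  repeat split.
  - intros a b Ha Hb.
    pose proof (Beta_pos a b Ha Hb). pose proof (Beta_pos a (b + 1) Ha ltac:(lra)).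
    pose proof (Beta_Sr a b Ha Hb) as E0. pose proof (Beta1_Sr a b Ha Hb) as E1.
    replace (Beta a (b + 1)) with (b * Beta a b / (a + b)) by (rewrite <- E0; field; lra).
    replace (Beta1 a (b + 1)) with ((Beta a b + b * Beta1 a b) / (a + b))
      by (rewrite <- E1; field; lra).
    field. lra.
  - intros a b Ha Hb.
    pose proof (Beta_pos a b Ha Hb).
    pose proof (Beta_Sr a b Ha Hb) as E0. pose proof (Beta1_Sr a b Ha Hb) as E1.
    pose proof (Beta_split a b Ha Hb) as S0. pose proof (Beta1_split a b Ha Hb) as S1.
    (* The shift in [a] follows by subtracting the shift in [b] from the splitting identity; the
       same is done for [Beta1]. *)
    replace (Beta (a + 1) b) with (a * Beta a b / (a + b)).
    2: { apply Rmult_eq_reg_l with (a + b); [|lra].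
         replace ((a + b) * (a * Beta a b / (a + b))) with (a * Beta a b) by (field; lra).
         nra. }
    replace (Beta1 (a + 1) b) with ((a * Beta1 a b - Beta a b) / (a + b)).
    2: { apply Rmult_eq_reg_l with (a + b); [|lra].
         replace ((a + b) * ((a * Beta1 a b - Beta a b) / (a + b)))
           with (a * Beta1 a b - Beta a b) by (field; lra).
         nra. }
    field. lra.
  - intros a Ha. rewrite Beta1_diag by exact Ha. unfold Rdiv. ring.
  - intros a b h Ha Hb Hh.
    pose proof (line_integral_Beta (a + h) b ltac:(lra) Hb) as H1.
    pose proof (line_integral_Beta1 (a + h) b ltac:(lra) Hb) as H2.
    pose proof (line_integral_Beta a (b + h) Ha ltac:(lra)) as H3.
    pose proof (line_integral_Beta1 a (b + h) Ha ltac:(lra)) as H4.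
    unfold beta_kernel in H1, H2, H3, H4.
    (* With equal sums both kernels share one logistic weight and differ only by the tilt [h]. *)
    replace (a + (b + h)) with (a + h + b) in H3, H4 by ring.
    refine (tilted_mean_le _ b h _ _ _ _ Hh _ H1 H2 H3 H4).
    intros t. apply exp_pos.
Qed.

(** * The Gamma integral *)

Lemma line_integral_Gamma (x : R) :
  0 < x -> line_integral (fun t => exp (x * t) * exp (- exp t)) (Gamma x).
Proof.
  intros Hx.
  pose proof (exp_decay_RInt_gen _ (exp_decay_gamma_kernel x Hx)) as HI.
  set (l := RInt_gen (fun t => exp (x * t) * exp (- exp t)) _ _) in HI.
  replace (Gamma x) with l; [exact HI |].
  symmetry. unfold Gamma, int0inf. apply is_RInt_gen_unique.
  apply (is_RInt_gen_subst _ exp exp ln (Rbar_locally m_infty) (Rbar_locally p_infty)).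
  - apply filter_filter.
  - apply filter_filter.
  - exact is_derive_exp.
  - exact continuous_exp.
  - intros t. pose proof (exp_pos t).
    apply (ex_derive_continuous (V := R_NormedModule)). unfold Rpower. auto_derive. lra.
  - exact is_lim_ln_0.
  - exact is_lim_ln_p.
  - exists (mkposreal 1 Rlt_0_1). intros y _ Hpos. now apply exp_ln.
  - exists 0. intros y Hpos. now apply exp_ln.
  - destruct HI as [_ HI]. revert HI.
    apply is_RInt_gen_ext. apply filter_forall. intros _ t _.
    unfold Rpower. rewrite ln_exp, <- !exp_plus. f_equal. ring.
Qed.

(** In the variable [u = exp t] this is the integral of [ln u * u^(x-1) * exp (- u)], the derivative
    of [Gamma]. *)
Definition Gamma1 (x : R) : R :=
  RInt_gen (fun t => t * (exp (x * t) * exp (- exp t)))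
    (Rbar_locally m_infty) (Rbar_locally p_infty).

Lemma line_integral_Gamma1 (x : R) :
  0 < x -> line_integral (fun t => t * (exp (x * t) * exp (- exp t))) (Gamma1 x).
Proof.
  intros Hx.
  now apply exp_decay_RInt_gen, (exp_decay_mul_id (fun t => exp (x * t) * exp (- exp t))),
    exp_decay_gamma_kernel.
Qed.

Lemma Gamma_pos (x : R) : 0 < x -> 0 < Gamma x.
Proof.
  intros Hx. refine (line_integral_gt0 _ _ _ (line_integral_Gamma x Hx)).
  intros t. apply Rmult_lt_0_compat; apply exp_pos.
Qed.

Lemma is_derive_gamma_kernel (x t : R) :
  is_derive (fun t => exp (x * t) * exp (- exp t)) t
    (x * (exp (x * t) * exp (- exp t)) - exp ((x + 1) * t) * exp (- exp t)).
Proof.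
  auto_derive; [exact I |].
  replace ((x + 1) * t) with (x * t + t) by ring. rewrite exp_plus. ring.
Qed.

Lemma Gamma_S (x : R) : 0 < x -> Gamma (x + 1) = x * Gamma x.
Proof.
  intros Hx.
  pose proof (line_integral_lin _ _ x (-1) _ _ (line_integral_Gamma x Hx)
    (line_integral_Gamma (x + 1) ltac:(lra))) as H.
  cut (x * Gamma x + -1 * Gamma (x + 1) = 0); [lra |].
  apply (line_integral_unique _ _ _ H).
  apply line_integral_FTC with (fun t => exp (x * t) * exp (- exp t)).
  - now apply exp_decay_gamma_kernel.
  - intros t. replace (x * _ + _) with
      (x * (exp (x * t) * exp (- exp t)) - exp ((x + 1) * t) * exp (- exp t)) by ring.
    apply is_derive_gamma_kernel.
  - exact (proj1 H).
Qed.

(** The differentiated functional equation, obtained by integrating the derivative of [t] times the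
    Gamma kernel. *)
Lemma Gamma1_S (x : R) : 0 < x -> Gamma1 (x + 1) = Gamma x + x * Gamma1 x.
Proof.
  intros Hx.
  pose proof (line_integral_plus _ _ _ _ (line_integral_Gamma x Hx)
    (line_integral_lin _ _ x (-1) _ _ (line_integral_Gamma1 x Hx)
      (line_integral_Gamma1 (x + 1) ltac:(lra)))) as H.
  cut (Gamma x + (x * Gamma1 x + -1 * Gamma1 (x + 1)) = 0); [lra |].
  apply (line_integral_unique _ _ _ H).
  apply line_integral_FTC with (fun t => t * (exp (x * t) * exp (- exp t))).
  - now apply (exp_decay_mul_id (fun t => exp (x * t) * exp (- exp t))),
      exp_decay_gamma_kernel.
  - intros t. replace (_ + (x * _ + _)) with (1 * (exp (x * t) * exp (- exp t)) +
      t * (x * (exp (x * t) * exp (- exp t)) - exp ((x + 1) * t) * exp (- exp t))) by ring.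
    apply (is_derive_id_mult (fun t => exp (x * t) * exp (- exp t))),
      is_derive_gamma_kernel.
  - exact (proj1 H).
Qed.

Lemma is_derive_Gamma (x : R) : 0 < x -> is_derive Gamma x (Gamma1 x).
Proof.
  (* The radius [x] keeps [x + h] positive. *)
  intros Hx. apply is_derive_laplace with (fun t => exp (- exp t)) x.
  - exact Hx.
  - now apply exp_decay_gamma_kernel.
  - intros h Hh. apply Rabs_def2 in Hh. apply line_integral_Gamma. lra.
  - now apply line_integral_Gamma1.
Qed.

Lemma Psi_eq (x : R) : 0 < x -> Psi x = Gamma1 x / Gamma x.
Proof.
  intros Hx. apply is_derive_unique.
  apply (is_derive_comp (V := R_NormedModule) ln Gamma x (/ Gamma x)).
  - now apply is_derive_ln, Gamma_pos.
  - now apply is_derive_Gamma.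
Qed.

(** [Psi x] is the mean of [t] under the density proportional to [exp (x * t - exp t)], so
    [tilted_mean_le] makes it increasing; the shifts come from [Gamma_S] and [Gamma1_S]. *)
Lemma digamma_gap_Psi : digamma_gap (fun a b => Psi b - Psi a).
Proof.
  assert (HS : forall x, 0 < x -> Psi (x + 1) = Psi x + / x).
  { intros x Hx. pose proof (Gamma_pos x Hx).
    rewrite !Psi_eq, Gamma_S, Gamma1_S by lra. field. lra. }
  assert (Hmono : forall x h, 0 < x -> 0 <= h -> Psi x <= Psi (x + h)).
  { intros x h Hx Hh. rewrite !Psi_eq by lra.
    apply (tilted_mean_le (fun t => exp (- exp t)) x h).
    - exact Hh.
    - intros t. apply exp_pos.
    - now apply line_integral_Gamma.
    - now apply line_integral_Gamma1.
    - apply line_integral_Gamma. lra.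
    - apply line_integral_Gamma1. lra. }
  repeat split.
  - intros a b Ha Hb. rewrite HS by exact Hb. ring.
  - intros a b Ha Hb. rewrite HS by exact Ha. ring.
  - intros a Ha. ring.
  - intros a b h Ha Hb Hh.
    pose proof (Hmono a h Ha Hh). pose proof (Hmono b h Hb Hh). lra.
Qed.

Lemma Beta1_eq (a b : R) : 0 < a -> 0 < b -> Beta1 a b = Beta a b * (Psi b - Psi a).
Proof.
  intros Ha Hb. pose proof (Beta_pos a b Ha Hb).
  rewrite <- (digamma_gap_unique _ _ a b digamma_gap_Beta digamma_gap_Psi Ha Hb).
  field. lra.
Qed.
(** * The score integral *)

Lemma cc_pos (i n : nat) : 0 < cc i n.
Proof.
  apply Rdiv_lt_0_compat; [|apply Rmult_lt_0_compat]; apply INR_fact_lt_0.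
Qed.

Definition log_density (i n : nat) (alpha beta x : R) : R :=
  ln (cc i n * beta / alpha) + (INR i * beta - 1) * ln (x / alpha)
  - (INR n + 1) * ln (1 + exp (beta * ln (x / alpha))).

(** [Rpower] unfolds to [exp] of a multiple of [ln] whatever the sign of its base, so the identity
    holds for every real [x]. *)
Lemma f_os_exp (i n : nat) (alpha beta x : R) :
  0 < alpha -> 0 < beta ->
  f_os i n alpha beta x = exp (log_density i n alpha beta x).
Proof.
  intros Ha Hb. pose proof (cc_pos i n) as Hc.
  assert (0 < cc i n * beta / alpha).
  { apply Rdiv_lt_0_compat; [now apply Rmult_lt_0_compat | exact Ha]. }
  unfold f_os, log_density, Rpower, Rminus.
  rewrite !exp_plus, exp_Ropp, exp_ln by assumption.
  field. split; [apply Rgt_not_eq, exp_pos | lra].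
Qed.

Lemma score_eq (i n : nat) (alpha beta x : R) :
  0 < alpha -> 0 < beta ->
  score i n alpha beta x =
    / beta + ln (x / alpha) *
      (INR i - (INR n + 1) * (exp (beta * ln (x / alpha)) / (1 + exp (beta * ln (x / alpha))))).
Proof.
  intros Ha Hb. pose proof (cc_pos i n) as Hc. unfold score.
  rewrite (Derive_ext_loc _ (fun b => log_density i n alpha b x)).
  - apply is_derive_unique. unfold log_density.
    pose proof (exp_pos (beta * ln (x / alpha))) as He.
    assert (0 < cc i n * beta / alpha).
    { apply Rdiv_lt_0_compat; [now apply Rmult_lt_0_compat | exact Ha]. }
    auto_derive.
    + repeat split; lra.
    + field. repeat split; lra.
  (* The exponential form is available for positive shapes only; the ball of radius [beta] around
     [beta] stays inside them. *)
  - exists (mkposreal beta Hb). intros b Hball.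
    change (Rabs (b - beta) < beta) in Hball. apply Rabs_def2 in Hball.
    rewrite f_os_exp by lra. apply ln_exp.
Qed.

Lemma filterlim_log_scale_at_right (alpha beta : R) :
  0 < alpha -> 0 < beta ->
  filterlim (fun x => beta * ln (x / alpha)) (at_right 0) (Rbar_locally m_infty).
Proof.
  intros Ha Hb P [M HM].
  assert (Hd : 0 < alpha * exp (M / beta)) by (apply Rmult_lt_0_compat; [lra | apply exp_pos]).
  exists (mkposreal _ Hd). intros x Hx Hpos. apply HM.
  change (Rabs (x - 0) < alpha * exp (M / beta)) in Hx.
  rewrite Rminus_0_r, Rabs_pos_eq in Hx by lra.
  assert (Hln : ln (x / alpha) < M / beta).
  { rewrite <- (ln_exp (M / beta)). apply ln_increasing; [now apply Rdiv_lt_0_compat |].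
    apply Rmult_lt_reg_l with alpha; [exact Ha |].
    replace (alpha * (x / alpha)) with (x * 1) by (field; lra). lra. }
  apply (Rmult_lt_compat_l beta) in Hln; [|exact Hb].
  replace (beta * (M / beta)) with M in Hln by (field; lra). exact Hln.
Qed.

Lemma filterlim_log_scale_p_infty (alpha beta : R) :
  0 < alpha -> 0 < beta ->
  filterlim (fun x => beta * ln (x / alpha)) (Rbar_locally p_infty) (Rbar_locally p_infty).
Proof.
  intros Ha Hb P [M HM].
  exists (alpha * exp (M / beta)). intros x Hx. apply HM.
  assert (Hln : M / beta < ln (x / alpha)).
  { rewrite <- (ln_exp (M / beta)). apply ln_increasing; [apply exp_pos |].
    apply Rmult_lt_reg_l with alpha; [exact Ha |].
    replace (alpha * (x / alpha)) with x by (field; lra). lra. }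
  apply (Rmult_lt_compat_l beta) in Hln; [|exact Hb].
  replace (beta * (M / beta)) with M in Hln by (field; lra). exact Hln.
Qed.

(** The leading factor is the derivative of [x] in [t]. It raises the exponent
    [(tau + 1) * (i - 1 / beta)] of [exp t] in the power of the density by [1 / beta], which gives
    [b]. *)
Lemma weighted_score_subst (i n : nat) (alpha beta tau a b t : R) :
  0 < alpha -> 0 < beta ->
  a + b = (INR n + 1) * (tau + 1) -> b = INR i * (tau + 1) - tau / beta ->
  let x := alpha * exp (t / beta) in
  alpha / beta * exp (t / beta) *
    (score i n alpha beta x * Rpower (f_os i n alpha beta x) (tau + 1)) =
  Rpower (beta / alpha) tau * Rpower (cc i n) (tau + 1) / beta *
    (beta_kernel a b t + (INR i * (t * beta_kernel a b t)
       + - (INR n + 1) * (t * beta_kernel a (b + 1) t))).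
Proof.
  intros Ha Hb Hs Eb x. pose proof (cc_pos i n) as Hc. pose proof (exp_pos t) as Ht.
  assert (Hba : 0 < beta / alpha) by now apply Rdiv_lt_0_compat.
  assert (Ex : ln (x / alpha) = t / beta).
  { unfold x. replace (alpha * exp (t / beta) / alpha) with (exp (t / beta)) by (field; lra).
    apply ln_exp. }
  rewrite score_eq, f_os_exp by assumption. unfold log_density, Rpower at 1. rewrite Ex, ln_exp.
  replace (beta * (t / beta)) with t by (field; lra).
  assert (E1 : beta_kernel a (b + 1) t = beta_kernel a b t * (exp t / (1 + exp t))).
  { unfold beta_kernel. replace (a + (b + 1)) with (a + b + 1) by ring.
    rewrite <- (logistic_weight_S (a + b) t).
    replace ((b + 1) * t) with (b * t + t) by ring. rewrite exp_plus. field. lra. }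
  rewrite E1.
  (* The factors [beta / alpha] and [exp (- (t / beta))] are split off to cancel the derivative of
     the substitution; the remaining [/ beta] comes from the score. *)
  assert (E2 : exp ((tau + 1) * (ln (cc i n * beta / alpha) + (INR i * beta - 1) * (t / beta)
                 - (INR n + 1) * ln (1 + exp t)))
             = Rpower (beta / alpha) tau * Rpower (cc i n) (tau + 1) * (beta / alpha)
               * exp (- (t / beta)) * beta_kernel a b t).
  { unfold beta_kernel, logistic_weight, Rpower. rewrite Hs.
    rewrite <- (exp_ln (beta / alpha)) at 2 by exact Hba.
    rewrite <- !exp_plus. f_equal.
    replace (cc i n * beta / alpha) with (cc i n * (beta / alpha)) by (field; lra).
    rewrite ln_mult by assumption. rewrite Eb. field. lra. }
  rewrite E2, exp_Ropp. pose proof (exp_pos (t / beta)). field. repeat split; lra.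
Qed.

Lemma line_integral_score (i n : nat) (beta tau a b : R) :
  0 < beta -> 0 <= tau -> 0 < a -> 0 < b ->
  a + b = (INR n + 1) * (tau + 1) -> b = INR i * (tau + 1) - tau / beta ->
  line_integral (fun t => beta_kernel a b t + (INR i * (t * beta_kernel a b t)
                   + - (INR n + 1) * (t * beta_kernel a (b + 1) t)))
    (Beta a b * (tau / (1 + tau)) * (/ beta * (Psi b - Psi a) + 1)).
Proof.
  intros Hbeta Htau Ha Hb Hs Eb.
  replace (Beta a b * (tau / (1 + tau)) * (/ beta * (Psi b - Psi a) + 1))
    with (Beta a b + (INR i * Beta1 a b + - (INR n + 1) * Beta1 a (b + 1))).
  - apply line_integral_plus; [now apply line_integral_Beta |].
    apply line_integral_lin; apply line_integral_Beta1; lra.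
  (* Eliminating [Beta1 a (b + 1)] leaves [Beta a b] with coefficient [1 - 1 / (tau + 1)] and
     [Beta1 a b] with coefficient [i - b / (tau + 1) = tau / (beta * (tau + 1))], whence the common
     factor [tau / (1 + tau)]. *)
  - pose proof (Beta1_Sr a b Ha Hb) as E. rewrite Hs in E.
    replace (- (INR n + 1) * Beta1 a (b + 1)) with (- (Beta a b + b * Beta1 a b) / (tau + 1))
      by (rewrite <- E; field; lra).
    rewrite Beta1_eq by assumption.
    replace (INR i) with ((b + tau / beta) / (tau + 1)) by (rewrite Eb; field; lra).
    field. lra.
Qed.

Lemma is_RInt_gen_score (i n : nat) (alpha beta tau a b : R) :
  0 < alpha -> 0 < beta -> 0 <= tau -> 0 < a -> 0 < b ->
  a + b = (INR n + 1) * (tau + 1) -> b = INR i * (tau + 1) - tau / beta ->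
  is_RInt_gen
    (fun x => score i n alpha beta x * Rpower (f_os i n alpha beta x) (tau + 1))
    (at_right 0) (Rbar_locally p_infty)
    (Rpower (beta / alpha) tau * Rpower (cc i n) (tau + 1) / beta
       * Beta a b * (tau / (1 + tau)) * (/ beta * (Psi b - Psi a) + 1)).
Proof.
  intros Halpha Hbeta Htau Ha Hb Hs Eb.
  apply (is_RInt_gen_subst _ (fun t => alpha * exp (t / beta))
    (fun t => alpha / beta * exp (t / beta)) (fun x => beta * ln (x / alpha))
    (Rbar_locally m_infty) (Rbar_locally p_infty)).
  - apply filter_filter.
  - apply filter_filter.
  - intros t. auto_derive; [exact I | unfold Rdiv; ring].
  - intros t. apply (ex_derive_continuous (V := R_NormedModule)). auto_derive. lra.
  - intros t.
    apply continuous_ext with (fun x =>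
      (/ beta + ln (x / alpha) * (INR i - (INR n + 1) *
        (exp (beta * ln (x / alpha)) / (1 + exp (beta * ln (x / alpha)))))) *
      exp ((tau + 1) * log_density i n alpha beta x)).
    { intros x. rewrite score_eq, f_os_exp by assumption. unfold Rpower. now rewrite ln_exp. }
    apply (ex_derive_continuous (V := R_NormedModule)). unfold log_density. auto_derive.
    set (y := alpha * exp (t / beta)).
    assert (0 < y / alpha)
      by (apply Rdiv_lt_0_compat; [apply Rmult_lt_0_compat; [lra | apply exp_pos] | lra]).
    pose proof (exp_pos (beta * ln (y / alpha))). repeat split; lra.
  - now apply filterlim_log_scale_at_right.
  - now apply filterlim_log_scale_p_infty.
  - exists (mkposreal 1 Rlt_0_1). intros y _ Hpos.
    replace (beta * ln (y / alpha) / beta) with (ln (y / alpha)) by (field; lra).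
    rewrite exp_ln by now apply Rdiv_lt_0_compat. field. lra.
  - exists 0. intros y Hpos.
    replace (beta * ln (y / alpha) / beta) with (ln (y / alpha)) by (field; lra).
    rewrite exp_ln by now apply Rdiv_lt_0_compat. field. lra.
  - pose proof (line_integral_scal _
      (Rpower (beta / alpha) tau * Rpower (cc i n) (tau + 1) / beta) _
      (line_integral_score i n beta tau a b Hbeta Htau Ha Hb Hs Eb)) as H.
    rewrite <- !Rmult_assoc in H.
    refine (proj2 (line_integral_ext _ _ _ _ H)).
    intros t. symmetry. now apply weighted_score_subst.
Qed.

(** The first conjunct asserts convergence, which the equation for [xi] alone would not give because
    [RInt_gen] is total. *)
Theorem theorem8 (n i : nat) (alpha beta tau : R) :
  (1 <= n)%nat -> (1 <= i)%nat -> (i <= n)%nat ->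
  0 < alpha -> 0 < beta -> 0 <= tau ->
  INR i * beta * (tau + 1) > tau ->
  let a := (INR (n - i + 1) * tau * beta + INR (n - i + 1) * beta + tau) / beta in
  let b := (INR i * tau * beta + INR i * beta - tau) / beta in
  is_RInt_gen
    (fun x => score i n alpha beta x * Rpower (f_os i n alpha beta x) (tau + 1))
    (at_right 0) (Rbar_locally p_infty)
    (Rpower (beta / alpha) tau * Rpower (cc i n) (tau + 1) / beta
       * Beta a b * (tau / (1 + tau)) * (/ beta * (Psi b - Psi a) + 1))
  /\ xi i n alpha tau beta =
       Rpower (beta / alpha) tau * Rpower (cc i n) (tau + 1) / beta
       * Beta a b * (tau / (1 + tau)) * (/ beta * (Psi b - Psi a) + 1)
  /\ K i n alpha tau beta = J i n alpha (2 * tau) beta - (xi i n alpha tau beta) ^ 2.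
Proof.
  intros _ _ Hin Halpha Hbeta Htau Hi a b.
  (* Truncated subtraction agrees with real subtraction because [i <= n]. *)
  assert (Hn : INR (n - i + 1) = INR n - INR i + 1).
  { rewrite plus_INR, minus_INR by exact Hin. simpl; ring. }
  assert (Hni : 0 < INR (n - i + 1)) by (apply lt_0_INR; lia).
  assert (Hnib : 0 < INR (n - i + 1) * beta) by now apply Rmult_lt_0_compat.
  assert (Ha : 0 < a) by (apply Rdiv_lt_0_compat; nra).
  (* Positivity of [b] is the hypothesis relating [i], [beta] and [tau]. *)
  assert (Hb : 0 < b) by (apply Rdiv_lt_0_compat; lra).
  assert (Hint := is_RInt_gen_score i n alpha beta tau a b Halpha Hbeta Htau Ha Hb
    ltac:(unfold a, b; rewrite Hn; field; lra) ltac:(unfold b; field; lra)).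
  split; [exact Hint | split; [|reflexivity]].
  unfold xi, int0inf. now apply is_RInt_gen_unique.
Qed.
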